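(* Let $\mathcal H$ be a real Hilbert space, $t_0>0$, and let $f:\mathcal H\to\mathbb R$ be a $\mathcal C^1$ function which is $\mu$-strongly convex for some $\mu>0$, whose gradient is $L$-Lipschitz continuous, and let $x^\star$ be its unique minimizer. Let $e:[t_0,+\infty[\to\mathcal H$ and let $x:[t_0,+\infty[\to\mathcal H$ be a solution trajectory of $$\ddot x(t)+2\sqrt\mu\,\dot x(t)+\nabla f\big(x(t)+\beta\dot x(t)\big)+e(t)=0.$$ Define $\mathcal E(t)=f(x(t)+\beta\dot x(t))-\min_{\mathcal H}f+\frac12\|\sqrt\mu(x(t)-x^\star)+\dot x(t)\|^2$. Suppose (a) $0\le\beta\le\frac1{2\sqrt\mu}$ and (b) $\int_{t_0}^{+\infty}\|e(t)\|dt<+\infty$. Then: (i) for all $t\ge t_0$, $$\mathcal E(t)\le\mathcal E(t_0)e^{-\frac{\sqrt\mu}2(t-t_0)}+Me^{-\frac{\sqrt\mu}2t}\int_{t_0}^te^{\frac{\sqrt\mu}2\tau}\|e(\tau)\|d\tau,$$ where $M:=\sqrt{\mathcal E(t_0)/c}+\frac1{2c}\int_{t_0}^{+\infty}\|e(\tau)\|d\tau$ with $c=\frac{\min\{\mu,1\}}{4\max\{\beta^2L^2,1\}}$; consequently $\lim_{t\to+\infty}\mathcal E(t)=0$, $\lim_{t\to+\infty}f(x(t))=\min_{\mathcal H}f$, and $\lim_{t\to+\infty}\|x(t)-x^\star\|=\lim_{t\to+\infty}\|\nabla f(x(t))\|=\lim_{t\to+\infty}\|\dot x(t)\|=0$;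 (ii) if moreover $\|e(t)\|=\mathcal O(1/t^p)$ as $t\to+\infty$ for some $p>0$, then $\mathcal E(t)=\mathcal O(1/t^p)$, and as $t\to+\infty$: $f(x(t))-\min_{\mathcal H}f=\mathcal O(1/t^p)$, $\|x(t)-x^\star\|^2=\mathcal O(1/t^p)$, $\|\dot x(t)\|^2=\mathcal O(1/t^p)$, $\|\nabla f(x(t))\|^2=\mathcal O(1/t^p)$.
   Context: $f$ is $\mu$-strongly convex if $f-\frac\mu2\|\cdot\|^2$ is convex. *)

(* Defs.v *)
From HB Require Import structures.
From mathcomp Require Import all_boot all_order all_algebra.
From mathcomp Require Import all_classical all_reals all_analysis.
Set Implicit Arguments. Unset Strict Implicit. Unset Printing Implicit Defensive.
Import Order.TTheory GRing.Theory Num.Theory.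
Import numFieldNormedType.Exports.
Local Open Scope classical_set_scope.
Local Open Scope ring_scope.

(* A real Hilbert space is modelled as a complete normed space V whose norm
   is induced by a (symmetric, bilinear) inner product [ip]. *)
Definition inner_product (R : realType) (V : normedModType R)
  (ip : V -> V -> R) : Prop :=
  [/\ (forall x y, ip x y = ip y x),
      (forall (a : R) x y z, ip (a *: x + y) z = a * ip x z + ip y z)
    & (forall x, ip x x = `|x| ^+ 2)].

Definition is_gradient (R : realType) (V : normedModType R)
  (ip : V -> V -> R) (f : V -> R) (x g : V) : Prop :=
  differentiable f x /\ forall v, 'd f x v = ip g v.

Definition convex_fun (R : realType) (V : normedModType R) (g : V -> R) : Prop :=
  forall (x y : V) (l : R), 0 <= l <= 1 ->
    g (l *: x + (1 - l) *: y) <= l * g x + (1 - l) * g y.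

Definition strongly_convex (R : realType) (V : normedModType R)
  (mu : R) (f : V -> R) : Prop :=
  convex_fun (fun y => f y - mu / 2 * `|y| ^+ 2).

Definition bigO_pinfty (R : realType) (u v : R -> R) : Prop :=
  exists2 C : R, 0 < C & \forall t \near +oo, `|u t| <= C * `|v t|.

(* Main.v *)
Require Import Defs.
From HB Require Import structures.
From mathcomp Require Import all_boot all_order all_algebra.
From mathcomp Require Import all_classical all_reals all_analysis.
From mathcomp Require Import measurable_realfun ring lra.
Set Implicit Arguments.
Unset Strict Implicit.
Unset Printing Implicit Defensive.
Import Order.TTheory GRing.Theory Num.Theory.
Import numFieldNormedType.Exports.
Local Open Scope classical_set_scope.
Local Open Scope ring_scope.

(* With [s = sqrt mu], [y = x + beta x'], [v = s (x - x* ) + x'] and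
   [z = v + beta grad f(y)], strong convexity and the equation give
   [E' + (s / 2) E <= |z| |e|], while [c |z|^2 <= E].  Integrating the
   consequence [(sqrt E)' <= |e| / (2 sqrt c)] bounds [|z|] by [M], and then
   integrating [(E exp(s t / 2))' <= M exp(s t / 2) |e|] gives (i).  Under the
   decay assumption of (ii), [E] is compared with a multiple of [t^-p].

   Since [e] is only integrable in norm, [E'] is an everywhere existing
   derivative without further regularity, and an inequality [F' <= h] has to be
   integrated by hand: see [increment_le_Rintegral_closed]. *)

(** * Integrating a one-sided bound on a derivative *)

Lemma is_derive_near_right_le (R : realType) (F : R -> R) (x d m : R) :
  is_derive x 1 F d -> d < m ->
  \forall t \near x^'+, F t - F x <= m * (t - x).
Proof.
move=> [dF Fd] dm.
have Fcvg : h^-1 *: (F (h + x) - F x) @[h --> 0^'] --> d.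
  have := dF; rewrite /derivable -[X in _ --> X -> _]/(derive F x 1) Fd.
  by rewrite /= /shift /=; under eq_cvg do rewrite [_%:A]mulr1.
have [r /= r0 rP] := cvgr_lt _ Fcvg _ dm.
near=> t.
have xt : x < t by near: t; exact: nbhs_right_gt.
have tx0 : 0 < t - x by rewrite subr_gt0.
have /rP : ball (0 : R) r (t - x).
  rewrite /ball /= sub0r normrN gtr0_norm// ltrBlDr addrC.
  by near: t; apply: nbhs_right_lt; rewrite ltrDl.
move=> /(_ (lt0r_neq0 tx0)) /=.
rewrite subrK [_ *: _]mulrC ltr_pdivrMr// => /ltW.
exact.
Unshelve. all: by end_near. Qed.

(** A supremum argument: the set [S] of points up to which the increments compare contains its
    supremum, since [F] is continuous and [G] is monotone. If that supremum were below [b], the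
    local bound to its right would produce a larger element of [S]. *)
Lemma increment_le_of_near_right (R : realType) (F G : R -> R) (a b : R) :
  a <= b ->
  (forall x, a <= x <= b -> {for x, continuous F}) ->
  {in `[a, b] &, {homo G : x y / x <= y}} ->
  (forall x, a <= x < b -> \forall t \near x^'+, F t - F x <= G t - G x) ->
  F b - F a <= G b - G a.
Proof.
move=> ab cF ndG loc.
pose S := [set t | a <= t <= b /\ F t - F a <= G t - G a].
have Sa : S a by split; rewrite ?lexx ?ab// !subrr.
have supS : has_sup S by split; [exists a | exists b => t [/andP[]]].
have Sle t : S t -> t <= sup S by exact: sup_upper_bound.
have asup : a <= sup S by exact: Sle.
have supb : sup S <= b by apply: ge_sup; [exists a | move=> t [/andP[]]].
have Ssup : S (sup S).
  split; first by rewrite asup.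
  (* Otherwise [F] exceeds [F a + G (sup S) - G a] near [sup S], hence at some [s] in [S]. There
     [F s <= F a + G s - G a], and [G s <= G (sup S)] contradicts it. *)
  rewrite leNgt; apply/negP => lt_sup.
  have cFs := cF _ (introT andP (conj asup supb)).
  have : F a + G (sup S) - G a < F (sup S) by lra.
  move=> /(cvgr_gt _ cFs) /nbhs_ballP[r /= r0 rP].
  have [s Ss srS] := sup_adherent r0 supS.
  have ss := Sle _ Ss.
  have /rP : ball (sup S) r s.
    by rewrite /ball /= ger0_norm ?subr_ge0//; lra.
  case: Ss => /andP[as_ sb] Fs /=.
  have : G s <= G (sup S) by apply: ndG; rewrite ?in_itv/= ?as_ ?asup.
  by lra.
have [<-|supNb] := eqVneq (sup S) b; first exact: Ssup.2.
have {}supNb : sup S < b by rewrite lt_neqAle supNb.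
have {}loc := loc _ (introT andP (conj asup supNb)).
near (sup S)^'+ => t.
have st : sup S < t by near: t; exact: nbhs_right_gt.
have tb : t < b by near: t; exact: nbhs_right_lt.
have Ft : F t - F (sup S) <= G t - G (sup S) by near: t.
have /Sle : S t.
  split; first by rewrite (ltW tb) (le_trans asup (ltW st)).
  by move: Ssup.2; lra.
by rewrite leNgt st.
Unshelve. all: by end_near. Qed.

(* [psi t] is the total length in [ ]-oo, t] ] of open sets [U_k] that contain
   [N] and have measure [eps / 2^(k+1)]. *)
Lemma negligible_steep_function (R : realType) (N : set R) (eps : R) :
  (@lebesgue_measure R).-negligible N -> 0 < eps ->
  exists psi : R -> R,
    [/\ {homo psi : x y / x <= y},
        (forall x y, psi y - psi x <= eps)
      & (forall x m, N x -> \forall t \near x^'+, m * (t - x) <= psi t - psi x)].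
Proof.
move=> [A [mA A0 NA]] eps0.
have e0 k : 0 < eps / (2 ^ k.+1)%:R by rewrite divr_gt0// ltr0n expn_gt0.
have Aoo : (lebesgue_measure A < +oo)%E by rewrite A0.
have /choice[U HU] : forall k : nat, exists V : set R,
    [/\ open V, N `<=` V & (lebesgue_measure V <= (eps / (2 ^ k.+1)%:R)%:E)%E].
  move=> k; have [V [oV AV VA]] := lebesgue_regularity_outer mA Aoo (e0 k).
  exists V; split => //; first exact: subset_trans NA AV.
  have mV : measurable V by exact: open_measurable.
  (* Outer regularity bounds the measure of [V] minus [A] only; [A] itself is null. *)
  rewrite -(setDUK AV) measureU ?setDIK//; last exact: measurableD.
  rewrite [X in (X + _)%E]A0 add0e; exact: ltW.
have mU k : @measurable _ (measurableTypeR R) (U k) by apply: open_measurable; have [] := HU k.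
pose mu : {measure set (measurableTypeR R) -> \bar R} := lebesgue_measure.
pose m : {measure set (measurableTypeR R) -> \bar R} :=
  mseries (fun k => mrestr mu (mU k)) 0.
have meps B : measurable B -> (m B <= eps%:E)%E.
  move=> mB; rewrite /m/= /mseries.
  apply: (@le_trans _ _ (\sum_(0 <= k <oo) (0 + (eps / (2 ^ k.+1)%:R)%:E))%E).
    apply: lee_nneseries => // k _; rewrite add0e.
    apply: (@le_trans _ _ (lebesgue_measure (U k))); last by have [] := HU k.
    apply: le_measure; [rewrite inE|rewrite inE|exact: subIsetr].
    - exact: measurableI.
    - exact: mU.
  apply: le_trans (@epsilon_trick R (fun=> 0%E) eps xpredT _ (ltW eps0)) _ => //.
  by rewrite eseries0// ?add0e.
have mfin B : measurable B -> m B \is a fin_num.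
  by move=> mB; rewrite ge0_fin_numE// (le_lt_trans (meps _ mB))// ltry.
pose psi t := fine (m `]-oo, t]%classic).
have psiB x y : x <= y -> psi y - psi x = fine (m `]x, y]%classic).
  move=> xy; apply/eqP; rewrite subr_eq addrC; apply/eqP.
  rewrite /psi -fineD ?mfin//; congr fine.
  rewrite -measureU//; last first.
    apply/seteqP; split => z //=; rewrite !in_itv/= => -[zx /andP[xz _]].
    by move: xz; rewrite ltNge zx.
  by rewrite -itv_bndbnd_setU.
have psi_ge0 t : 0 <= psi t by rewrite fine_ge0.
have psi_le t : psi t <= eps by rewrite -lee_fin fineK ?mfin// meps.
exists psi; split.
- by move=> x y xy; rewrite -subr_ge0 psiB// fine_ge0.
- by move=> x y; have := psi_ge0 x; have := psi_le y; lra.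
- move=> x c Nx; have [n cn] : exists n : nat, c <= n%:R.
    exists (Num.truncn `|c|).+1.
    by apply: le_trans (ler_norm c) _; apply/ltW/truncnS_gt.
  (* Close enough to [x], the interval []x, t]] lies in the first [n] open sets. Each of them
     contributes [t - x] to [psi t - psi x], so the slope is at least [n >= c]. *)
  have : \forall t \near x^'+, forall k, (k < n)%N -> `]x, t] `<=` U k.
    elim: n {cn} => [|n IH]; first by near=> t.
    have [oUn NUn _] := HU n.
    have /nbhs_ballP[r /= r0 rP] : nbhs x (U n).
      by apply: open_nbhs_nbhs; split => //; exact: NUn.
    near=> t.
    have IHt : forall k, (k < n)%N -> `]x, t] `<=` U k by near: t.
    have tr : t < x + r by near: t; apply: nbhs_right_lt; rewrite ltrDl.
    move=> k; rewrite ltnS leq_eqVlt => /orP[/eqP->|]; last exact: IHt.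
    move=> z /=; rewrite in_itv/= => /andP[xz zt]; apply: rP.
    by rewrite /ball /= distrC gtr0_norm ?subr_gt0//; lra.
  move=> nearU; near=> t.
  have xt : x < t by near: t; exact: nbhs_right_gt.
  have Ut : forall k, (k < n)%N -> `]x, t] `<=` U k by near: t.
  rewrite psiB ?(ltW xt)// -lee_fin fineK ?mfin//.
  apply: (@le_trans _ _ (n%:R * (t - x))%:E).
    by rewrite lee_fin ler_wpM2r// subr_ge0 ltW.
  rewrite /m/= /mseries; apply: le_trans (nneseries_lim_ge n _) => //.
  rewrite (eq_big_nat _ _ (F2 := fun=> (t - x)%:E)).
    rewrite big_mkord sumEFin sumr_const card_ord lee_fin mulr_natl.
    exact: lexx.
  move=> k /andP[_ kn]; transitivity (mu `]x, t]%classic).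
    by congr (mu _); apply/setIidl; exact: Ut.
  by apply: etrans (lebesgue_measure_itv _) _; rewrite /= lte_fin xt -EFinB.
Unshelve. all: by end_near. Qed.

(* Let [H] be the indefinite integral of [h].  Almost everywhere [H' = h >= F'];
   on the exceptional null set [H] is still nondecreasing and [F'] is finite, so
   that adding a small [psi] with infinite derivative there makes [F - H - psi]
   decrease locally to the right of every point, up to a small slope. *)
Lemma increment_le_Rintegral_closed (R : realType) (F dF h : R -> R) (a b : R) :
  a <= b ->
  (forall t, a <= t <= b -> is_derive t 1 F (dF t)) ->
  (forall t, a <= t <= b -> 0 <= h t) ->
  (forall t, a <= t <= b -> dF t <= h t) ->
  (@lebesgue_measure R).-integrable `[a, b] (EFin \o h) ->
  F b - F a <= Rintegral lebesgue_measure `[a, b] h.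
Proof.
move=> ab derF h0 dFh inth.
(* Extending [h] by zero makes it integrable on the whole line, so that [H] can start at minus
   infinity, as in the almost everywhere differentiation theorem [FTC1Ny]. *)
pose k := h \_ `[a, b].
have k0 t : 0 <= k t.
  by rewrite /k patchE; case: ifPn => //; rewrite inE/= in_itv/= => /h0.
have intk : (@lebesgue_measure R).-integrable setT (EFin \o k).
  by move: inth; rewrite integrable_mkcond//= (restrict_EFin h).
have intkS A : measurable A -> (@lebesgue_measure R).-integrable A (EFin \o k).
  by move=> mA; apply: integrableS intk => //.
have lock : locally_integrable [set: R] k by exact: integrable_locally.
pose H t := (\int[lebesgue_measure]_(u in `]-oo, t]) k u)%R.
have HB x y : x <= y ->
    H y - H x = (\int[lebesgue_measure]_(u in `]x, y]) k u)%R.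
  move=> xy; rewrite /H; apply: Rintegral_itvB => //.
    exact: intkS.
have H_nd : {homo H : x y / x <= y}.
  by move=> x y xy; rewrite -subr_ge0 HB//; exact: Rintegral_ge0.
have HabE : H b - H a = Rintegral lebesgue_measure `[a, b] h.
  rewrite HB// Rintegral_itv_obnd_cbnd; last exact: intkS.
  by apply: eq_Rintegral => t tab; rewrite /k patchE tab.
have := FTC1Ny (fun y => intkS _ (measurable_itv `]-oo, y])) lock.
rewrite -/H /=; set P := (X in {ae _, forall x, X x}) => aeP.
rewrite -HabE; apply/ler_addgt0Pr => eps eps0.
(* [d] bounds the total growth of [psi] and is also the extra slope in [G]. The total error is
   therefore [d + d * (b - a) = eps]. *)
pose d := eps / (1 + (b - a)).
have d0 : 0 < d by rewrite divr_gt0// ltr_pwDl// subr_ge0.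
have [psi [psi_nd psi_le psi_steep]] := negligible_steep_function aeP d0.
pose G t := H t + psi t + d * t.
suff : F b - F a <= G b - G a.
  have : d * (1 + (b - a)) = eps by rewrite /d divfK// gt_eqF// ltr_pwDl// subr_ge0.
  by rewrite /G; have := psi_le a b; lra.
apply: increment_le_of_near_right => //.
- move=> x /derF [+ _]; move=> /derivable1_diffP; exact: differentiable_continuous.
- move=> x y _ _ xy; rewrite /G.
  by rewrite lerD ?ler_wpM2l ?(ltW d0)// lerD// ?H_nd// psi_nd.
- move=> x /andP[ax xb].
  have axb : a <= x <= b by rewrite ax ltW.
  have [Px|NPx] := pselect (P x).
    have [dH Hd] : derivable H x 1 /\ H^`()%classic x = k x by exact: Px.
    have xab : x \in `[a, b]%classic by rewrite inE/= in_itv.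
    have kx : k x = h x by rewrite /k patchE xab.
    have derH : is_derive x 1 (F - H) (dF x - k x).
      have := derF _ axb; have : is_derive x 1 H (k x).
        by split => //; rewrite -derive1E.
      by move=> ? ?; exact: is_deriveB.
    have lt_d : dF x - k x < d by rewrite kx; have := dFh _ axb; lra.
    have := is_derive_near_right_le derH lt_d.
    apply: filterS2 (nbhs_right_gt x) => t xt.
    by rewrite !fctE /G; have := psi_nd _ _ (ltW xt); lra.
  (* At an exceptional point any finite slope above [dF x] will do, because [psi] alone grows at
     least that fast to the right of [x]. *)
  have lt1 : dF x < dF x + 1 by rewrite ltrDl.
  have := is_derive_near_right_le (derF _ axb) lt1.
  apply: filterS3 (nbhs_right_gt x) (psi_steep x (dF x + 1) NPx) => t xt.
  rewrite /G; have := H_nd _ _ (ltW xt).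
  have : 0 <= d * (t - x) by rewrite mulr_ge0 ?subr_ge0 ?ltW.
  by lra.
Qed.

Lemma ge0_subset_Rintegral_itv (R : realType) (i j : interval R) (h : R -> R) :
  [set` i] `<=` [set` j] ->
  (@lebesgue_measure R).-integrable [set` j] (EFin \o h) ->
  (forall t, t \in j -> 0 <= h t) ->
  Rintegral lebesgue_measure [set` i] h <= Rintegral lebesgue_measure [set` j] h.
Proof.
move=> ij inth h0.
have inti : (@lebesgue_measure R).-integrable [set` i] (EFin \o h).
  by apply: integrableS inth.
apply: fine_le; [exact: integrable_fin_num|exact: integrable_fin_num|].
apply: ge0_subset_integral => //; first by move/integrableP: inth => [].
Qed.

(** The closed version is applied on [[t, b]], whose integral is at most the one over [[a, b]]; then
    [t] tends to [a] from the right. This handles the initial time, where the trajectory is only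
    continuous. *)
Lemma increment_le_Rintegral (R : realType) (F dF h : R -> R) (a b : R) :
  a <= b ->
  F t @[t --> a^'+] --> F a ->
  (forall t, a < t <= b -> is_derive t 1 F (dF t)) ->
  (forall t, a <= t <= b -> 0 <= h t) ->
  (forall t, a < t <= b -> dF t <= h t) ->
  (@lebesgue_measure R).-integrable `[a, b] (EFin \o h) ->
  F b - F a <= Rintegral lebesgue_measure `[a, b] h.
Proof.
rewrite le_eqVlt => /predU1P[<- _ _ h0 _ _|].
  by rewrite subrr; apply: Rintegral_ge0 => t /=; rewrite in_itv/=; exact: h0.
move=> ab cF derF h0 dFh inth.
have cFb : F b - F t @[t --> a^'+] --> F b - F a.
  by apply: cvgB => //; exact: cvg_cst.
apply: (cvgr_to_le cFb); near=> t.
have at_ : a < t by near: t; exact: nbhs_right_gt.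
have tb : t < b by near: t; exact: nbhs_right_lt.
have sub : [set` `[t, b]] `<=` [set` `[a, b]].
  by apply: subset_itvr; rewrite bnd_simp ltW.
apply: le_trans (ge0_subset_Rintegral_itv sub inth _); last first.
  by move=> u; rewrite in_itv/=; exact: h0.
apply: (@increment_le_Rintegral_closed _ F dF h) => //; first exact: ltW.
- by move=> u /andP[tu ub]; apply: derF; rewrite ub (lt_le_trans at_).
- by move=> u /andP[tu ub]; apply: h0; rewrite ub ltW// (lt_le_trans at_).
- by move=> u /andP[tu ub]; apply: dFh; rewrite ub (lt_le_trans at_).
- exact: integrableS inth.
Unshelve. all: by end_near. Qed.

(** * Gradients and strong convexity in an inner product space *)

Section InnerProduct.
Context (R : realType) (V : normedModType R) (ip : V -> V -> R).
Hypothesis ipP : inner_product ip.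

Lemma ipC x y : ip x y = ip y x.
Proof. by case: ipP. Qed.

Lemma ip_norm x : ip x x = `|x| ^+ 2.
Proof. by case: ipP. Qed.

Lemma ipPl a x y z : ip (a *: x + y) z = a * ip x z + ip y z.
Proof. by case: ipP. Qed.

Lemma ip0l z : ip 0 z = 0.
Proof. by have := ipPl (-1) 0 0 z; rewrite scaler0 add0r; lra. Qed.

Lemma ipDl x y z : ip (x + y) z = ip x z + ip y z.
Proof. by rewrite -[x in LHS]scale1r ipPl mul1r. Qed.

Lemma ipZl a x z : ip (a *: x) z = a * ip x z.
Proof. by rewrite -[a *: x]addr0 ipPl ip0l addr0. Qed.

Lemma ipNl x z : ip (- x) z = - ip x z.
Proof. by rewrite -scaleN1r ipZl mulN1r. Qed.

Lemma ipDr x y z : ip z (x + y) = ip z x + ip z y.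
Proof. by rewrite ipC ipDl !(ipC z). Qed.

Lemma ipZr a x z : ip z (a *: x) = a * ip z x.
Proof. by rewrite ipC ipZl (ipC z). Qed.

Lemma ipNr x z : ip z (- x) = - ip z x.
Proof. by rewrite ipC ipNl (ipC z). Qed.

Lemma normD_sqr x y : `|x + y| ^+ 2 = `|x| ^+ 2 + 2 * ip x y + `|y| ^+ 2.
Proof. by rewrite -!ip_norm !(ipDl, ipDr) (ipC y x); lra. Qed.

(** The Cauchy-Schwarz inequality, obtained by squaring the triangle inequality. *)
Lemma ip_le_normM x y : ip x y <= `|x| * `|y|.
Proof.
have : `|x + y| ^+ 2 <= (`|x| + `|y|) ^+ 2.
  by rewrite lerXn2r ?nnegrE ?addr_ge0// ler_normD.
by rewrite normD_sqr; lra.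
Qed.

(** Reduces the continuity of [ip] to that of the norm; used for [cvg_ip]. *)
Lemma ip_polarization x y : ip x y = (`|x + y| ^+ 2 - `|x - y| ^+ 2) / 4.
Proof. by rewrite !normD_sqr ipNr normrN; lra. Qed.

Lemma cvg_ip (T : Type) (F : set_system T) (FF : Filter F) (u w : T -> V) x y :
  u t @[t --> F] --> x -> w t @[t --> F] --> y ->
  ip (u t) (w t) @[t --> F] --> ip x y.
Proof.
move=> ux wy; rewrite ip_polarization.
under eq_cvg do rewrite ip_polarization.
apply: cvgMl; apply: cvgB; rewrite !expr2.
  by under eq_cvg do rewrite expr2; apply: cvgM; apply: cvg_norm; exact: cvgD.
by under eq_cvg do rewrite expr2; apply: cvgM; apply: cvg_norm; exact: cvgB.
Qed.

(** By symmetry of [ip], the difference quotient of the squared norm is the inner product of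
    [v (h + t) + v t] with the difference quotient of [v]. *)
Lemma is_derive_norm_sqr (v : R -> V) (t : R) (dv : V) :
  is_derive t 1 v dv ->
  is_derive t 1 (fun s => `|v s| ^+ 2) (2 * ip (v t) dv).
Proof.
move=> [dvt vdv].
have cv : v (h + t) @[h --> (0 : R)^'] --> v t.
  have /differentiable_continuous : differentiable v t by exact/derivable1_diffP.
  move=> cvt.
  have : v (h + t) @[h --> (0 : R)] --> v t.
    have ct : h + t @[h --> (0 : R)] --> t.
      rewrite -[X in _ --> X]add0r.
      by apply: cvgD; [exact: cvg_id|exact: cvg_cst].
    exact: (cvg_comp _ _ ct cvt).
  by apply: cvg_trans; apply: cvg_app; exact: nbhs_dnbhs.
have qv : h^-1 *: (v (h + t) - v t) @[h --> (0 : R)^'] --> dv.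
  have := dvt; rewrite /derivable -[X in _ --> X -> _]/(derive v t 1) vdv.
  by rewrite /= /shift /=; under eq_cvg do rewrite [_%:A]mulr1.
have lim : h^-1 *: (((fun s => `|v s| ^+ 2) \o shift t) (h *: 1) - `|v t| ^+ 2)
    @[h --> (0 : R)^'] --> 2 * ip (v t) dv.
  have -> : 2 * ip (v t) dv = ip (v t + v t) dv by rewrite ipDl; lra.
  have : ip (v (h + t) + v t) (h^-1 *: (v (h + t) - v t))
      @[h --> (0 : R)^'] --> ip (v t + v t) dv.
    by apply: cvg_ip => //; apply: cvgD => //; exact: cvg_cst.
  apply: cvg_trans; apply: near_eq_cvg; apply: nearW => h /=.
  rewrite /shift /= [_%:A]mulr1 ipZr -!ip_norm !(ipDl, ipDr, ipNr).
  by rewrite (ipC (v t) (v (h + t))) /GRing.scale /=; ring.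
by split; [apply/cvg_ex; eexists; exact: lim|exact: cvg_lim lim].
Qed.

Lemma is_derive_gradient_comp (f : V -> R) (y : R -> V) (t : R) (g dy : V) :
  is_gradient ip f (y t) g -> is_derive t 1 y dy ->
  is_derive t 1 (f \o y) (ip g dy).
Proof.
move=> [df dfE] [dyt ydy].
have diffy : differentiable y t by exact/derivable1_diffP.
have diffc : differentiable (f \o y) t by exact: differentiable_comp.
split; first exact/derivable1_diffP.
by rewrite deriveE// diff_comp//= dfE -deriveE// ydy.
Qed.

Lemma is_derive_line (y w : V) (t : R) :
  is_derive t 1 (fun l : R => y + l *: w) w.
Proof.
have lim : h^-1 *: (((fun l : R => y + l *: w) \o shift t) (h *: 1) - (y + t *: w))
    @[h --> (0 : R)^'] --> w.
  have : w @[_ --> (0 : R)^'] --> w by exact: cvg_cst.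
  apply: cvg_trans; apply: near_eq_cvg; near=> h.
  have h0 : h != 0 by near: h; exact: nbhs_dnbhs_neq.
  rewrite /= /shift /= [_%:A]mulr1 scalerDl opprD addrACA subrr add0r addrK.
  by rewrite scalerA mulVf// scale1r.
by split; [apply/cvg_ex; eexists; exact: lim|exact: cvg_lim lim].
Unshelve. all: by end_near. Qed.

Lemma is_derive_gradient_line (f : V -> R) (y g w : V) :
  is_gradient ip f y g ->
  is_derive (0 : R) 1 (fun l => f (y + l *: w)) (ip g w).
Proof.
move=> fg; apply: (@is_derive_gradient_comp f (fun l => y + l *: w)).
  by rewrite scale0r addr0.
exact: is_derive_line.
Qed.

Lemma gradient_minimizer_eq0 (f : V -> R) (y g : V) :
  is_gradient ip f y g -> (forall z, f y <= f z) -> g = 0.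
Proof.
move=> /(@is_derive_gradient_line f y g (- g)) fg fmin; apply/eqP/negPn/negP => gN0.
have g0 : 0 < `|g| ^+ 2 by rewrite exprn_gt0// normr_gt0.
(* A short step along [- g] would decrease [f] at a rate of at least half of the squared norm of
   [g]. *)
have lt : ip g (- g) < - (`|g| ^+ 2 / 2) by rewrite ipNr ip_norm; lra.
have nearR := is_derive_near_right_le fg lt.
near (0 : R)^'+ => l.
have l0 : 0 < l by near: l; exact: nbhs_right_gt.
have : f (y + l *: - g) - f (y + (0 : R) *: - g) <= - (`|g| ^+ 2 / 2) * (l - 0).
  by near: l.
rewrite scale0r addr0 subr0; have := fmin (y + l *: - g).
have : 0 < l * (`|g| ^+ 2 / 2) by rewrite mulr_gt0// divr_gt0.
by lra.
Unshelve. all: by end_near. Qed.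

(** Along the segment from [y] to [z], strong convexity bounds [f] by a quadratic in [l] with slope
    [B] at 0. A directional derivative above [B] would violate this bound for small [l]. *)
Lemma strongly_convex_gradient_le (f : V -> R) (mu : R) (y z g : V) :
  strongly_convex mu f -> is_gradient ip f y g ->
  f y + ip g (z - y) + mu / 2 * `|z - y| ^+ 2 <= f z.
Proof.
move=> cf /(@is_derive_gradient_line f y g (z - y)) fg.
set D := `|z - y| ^+ 2; set B := f z - f y - mu / 2 * D.
rewrite leNgt; apply/negP => lt.
have {}lt : B < ip g (z - y) by rewrite /B; lra.
(* The midpoint leaves room on both sides: [f] grows at least at rate [m] near 0, and the gap
   [m - B] beats the quadratic term once [l] is small. *)
pose m := (ip g (z - y) + B) / 2.
have mB : B < m by rewrite /m; lra.
have cvx l : 0 <= l <= 1 ->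
    f (y + l *: (z - y)) <= f y + l * B + l ^+ 2 * (mu / 2 * D).
  move=> l01; have := cf z y l l01.
  have -> : l *: z + (1 - l) *: y = y + l *: (z - y).
    by rewrite scalerBl scale1r scalerBr addrC addrA -!addrA; congr (_ + _); rewrite addrC.
  have -> : `|y + l *: (z - y)| ^+ 2 = l * `|z| ^+ 2 + (1 - l) * `|y| ^+ 2
      - l * (1 - l) * D.
    rewrite /D -!ip_norm !(ipDl, ipDr, ipZl, ipZr, ipNl, ipNr) (ipC z y); ring.
  by rewrite /B; lra.
have ltN : - ip g (z - y) < - m by rewrite /m; lra.
have nearR := is_derive_near_right_le (is_deriveN fg) ltN.
have C0 : 0 < `|mu / 2 * D| + 1 by rewrite ltr_wpDl.
near (0 : R)^'+ => l.
have l0 : 0 < l by near: l; exact: nbhs_right_gt.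
have l1 : l < 1 by near: l; exact: nbhs_right_lt.
have lm : l < (m - B) / (`|mu / 2 * D| + 1).
  by near: l; apply: nbhs_right_lt; rewrite divr_gt0// subr_gt0.
have : - f (y + l *: (z - y)) - - f (y + (0 : R) *: (z - y)) <= - m * (l - 0).
  by near: l.
rewrite scale0r addr0 subr0.
have := cvx l (introT andP (conj (ltW l0) (ltW l1))).
suff : 0 < l * (m - B - l * (mu / 2 * D)) by lra.
rewrite mulr_gt0// subr_gt0; move: lm; rewrite ltr_pdivlMr// => lm.
apply: le_lt_trans lm; apply: ler_wpM2l; first exact: ltW.
by apply: le_trans (ler_norm _) _; rewrite lerDl.
Unshelve. all: by end_near. Qed.

(* [p], [d], [g] and [w] stand for [x - x*], [x'], [grad f(x + beta x')] and [e];
   the two bounds on [phi = f(x + beta x') - min f] express strong convexity.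
   With [b = beta s <= 1/2], the left-hand side plus [(v + beta g, w)] is at most
   [- beta |g + (s/2) d|^2 - (s/2) |s p + ((3 b + 1)/2) d|^2
    - (s/8) (5 - 8 b - 3 b^2) |d|^2]. *)
Lemma energy_derivative_le (s beta phi : R) (p d dd g w : V) :
  0 < s -> 0 <= beta -> beta * s <= 1 / 2 ->
  s ^+ 2 / 2 * `|p + beta *: d| ^+ 2 <= phi ->
  phi + s ^+ 2 / 2 * `|p + beta *: d| ^+ 2 <= ip g (p + beta *: d) ->
  dd + (2 * s) *: d + g + w = 0 ->
  ip g (d + beta *: dd) + ip (s *: p + d) (s *: d + dd)
    + s / 2 * (phi + 1 / 2 * `|s *: p + d| ^+ 2)
  <= `|s *: p + d + beta *: g| * `|w|.
Proof.
move=> s0 beta0 bs1 phi_ge phi_le ode.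
have {ode}-> : dd = - ((2 * s) *: d + g + w).
  by apply/eqP; rewrite -addr_eq0 !addrA ode.
(* The perturbation enters only through this inner product; the remaining terms have a nonpositive
   sum. *)
apply: (@le_trans _ _ (- ip (s *: p + d + beta *: g) w)); last first.
  by rewrite -ipNr; apply: le_trans (ip_le_normM _ _) _; rewrite normrN.
have := sqr_ge0 `|g + (s / 2) *: d|.
have := sqr_ge0 `|s *: p + ((3 * (beta * s) + 1) / 2) *: d|.
have := sqr_ge0 `|d|.
move: phi_ge phi_le; rewrite -!ip_norm !(ipDl, ipDr, ipZl, ipZr, ipNl, ipNr).
rewrite (ipC d p) (ipC d g) (ipC g p).
set pp := ip p p; set pd := ip p d; set d2 := ip d d; set gg := ip g g.
set gd := ip g d; set pg := ip p g.
set pw := ip p w; set dw := ip d w; set gw := ip g w.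
move=> phi_ge phi_le d2_ge0 q1 q2.
(* For [beta * s] in [[0, 1/2]] the coefficient is at least [5 - 4 - 3/4 = 1/4]. *)
have r0 : 0 <= (5 - 8 * (beta * s) - 3 * (beta * s) ^+ 2) * d2.
  rewrite mulr_ge0//.
  have bs0 := mulr_ge0 beta0 (ltW s0).
  by nra.
(* In the final combination [phi_le] has weight [s] and [phi_ge] weight [s / 2]. *)
have := ler_wpM2l (ltW s0) phi_ge.
have := ler_wpM2l (ltW s0) phi_le.
have := mulr_ge0 (ltW s0) q1.
have := mulr_ge0 beta0 q2.
have := mulr_ge0 (ltW s0) r0.
by lra.
Qed.
End InnerProduct.

(** * Scaling and comparison for integrals, limits and big O *)

Lemma integrable_itvZl (R : realType) (i : interval R) (h : R -> R) (r : R) :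
  (@lebesgue_measure R).-integrable [set` i] (EFin \o h) ->
  (@lebesgue_measure R).-integrable [set` i] (EFin \o (fun u => r * h u)).
Proof.
move=> inth.
have : (@lebesgue_measure R).-integrable [set` i] (fun u => r%:E * (h u)%:E)%E.
  by apply: integrableZl.
by apply: eq_integrable => // u _; rewrite /= EFinM.
Qed.

Lemma cvg0_of_le_scale (R : realType) (u w : R -> R) (C : R) :
  (forall t, 0 <= u t) -> (forall t, u t <= C * w t) ->
  w t @[t --> +oo] --> 0 -> u t @[t --> +oo] --> 0.
Proof.
move=> u0 uw w0; apply: (@squeeze_cvgr _ _ _ _ (fun=> 0) (fun t => C * w t)).
- by apply: nearW => t; rewrite u0 uw.
- exact: cvg_cst.
- by rewrite -[X in _ --> X](mulr0 C); exact: cvgMr.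
Qed.

Lemma cvg0_of_sqr (R : realType) (u : R -> R) :
  (forall t, 0 <= u t) ->
  u t ^+ 2 @[t --> +oo] --> 0 -> u t @[t --> +oo] --> 0.
Proof.
move=> u0 su0.
have -> : u = (fun t => Num.sqrt (u t ^+ 2)).
  by apply/funext => t; rewrite sqrtr_sqr ger0_norm.
rewrite -[X in _ --> X]sqrtr0.
by apply: (cvg_comp (fun t => u t ^+ 2) Num.sqrt su0); exact: sqrt_continuous.
Qed.

Lemma bigO_pinfty_of_le_scale (R : realType) (u w r : R -> R) (C : R) :
  0 <= C -> (forall t, 0 <= u t) -> (forall t, u t <= C * w t) ->
  bigO_pinfty w r -> bigO_pinfty u r.
Proof.
(* [C] may be zero, while the constant in [bigO_pinfty] has to be positive. *)
move=> C0 u0 uw [K K0 wr]; exists ((C + 1) * K); first by rewrite mulr_gt0// ltr_wpDl.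
apply: filterS wr => t wr; rewrite ger0_norm// -mulrA.
have h1 := ler_wpM2l C0 (le_trans (ler_norm (w t)) wr).
have h2 := le_trans (normr_ge0 (w t)) wr.
by have := uw t; lra.
Qed.

(** * The energy along a trajectory *)

Section Trajectory.
Context (R : realType) (V : completeNormedModType R)
  (ip : V -> V -> R) (t0 mu L beta : R)
  (f : V -> R) (gf : V -> V) (xs : V)
  (e x dx ddx : R -> V).
Hypothesis ipP : inner_product ip.
Hypothesis mu_gt0 : 0 < mu.
Hypothesis gradf : forall y, is_gradient ip f y (gf y).
Hypothesis cvxf : strongly_convex mu f.
Hypothesis lipf : forall y z, `|gf y - gf z| <= L * `|y - z|.
Hypothesis minf : forall y, f xs <= f y.
Hypothesis cx : {within `[t0, +oo[, continuous x}.
Hypothesis cdx : {within `[t0, +oo[, continuous dx}.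
Hypothesis derx : forall t, t0 < t -> is_derive t 1 x (dx t).
Hypothesis derdx : forall t, t0 < t -> is_derive t 1 dx (ddx t).
Hypothesis ode : forall t, t0 < t ->
  ddx t + (2 * Num.sqrt mu) *: dx t + gf (x t + beta *: dx t) + e t = 0.
Hypothesis beta_le : 0 <= beta <= 1 / (2 * Num.sqrt mu).
Hypothesis inte :
  (@lebesgue_measure R).-integrable `[t0, +oo[ (fun t => (`|e t|)%:E).

Let s := Num.sqrt mu.
Let k := s / 2.
Let y t := x t + beta *: dx t.
Let v t := s *: (x t - xs) + dx t.
Let z t := v t + beta *: gf (y t).
Let E t := f (y t) - f xs + 1 / 2 * `|v t| ^+ 2.
Let c := Num.min mu 1 / (4 * Num.max (beta ^+ 2 * L ^+ 2) 1).
Let M := Num.sqrt (E t0 / c)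
  + 1 / (2 * c) * Rintegral lebesgue_measure `[t0, +oo[ (fun t => `|e t|).

Let s_gt0 : 0 < s. Proof. by rewrite sqrtr_gt0. Qed.

Let s_sqr : s ^+ 2 = mu. Proof. by rewrite sqr_sqrtr// ltW. Qed.

Let beta_ge0 : 0 <= beta. Proof. by case/andP: beta_le. Qed.

Let beta_s : beta * s <= 1 / 2.
Proof.
case/andP: beta_le => _; rewrite ler_pdivlMr ?mulr_gt0// -/s; lra.
Qed.

Let k_gt0 : 0 < k. Proof. by rewrite divr_gt0. Qed.

(** * Strong convexity around the minimizer *)

Lemma gradient_minimizer0 : gf xs = 0.
Proof. exact: (gradient_minimizer_eq0 ipP (gradf xs) minf). Qed.

Lemma minimizer_quadratic_growth u : mu / 2 * `|u - xs| ^+ 2 <= f u - f xs.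
Proof.
have := strongly_convex_gradient_le ipP u cvxf (gradf xs).
by rewrite gradient_minimizer0 (ip0l ipP); lra.
Qed.

Lemma minimizer_gradient_ge u :
  f u - f xs + mu / 2 * `|u - xs| ^+ 2 <= ip (gf u) (u - xs).
Proof.
have := strongly_convex_gradient_le ipP xs cvxf (gradf u).
by rewrite -opprB (ipNr ipP) normrN; lra.
Qed.

Lemma gradient_norm_le u : `|gf u| <= L * `|u - xs|.
Proof. by have := lipf u xs; rewrite gradient_minimizer0 subr0. Qed.

Lemma gradient_norm_sqr_le u : `|gf u| ^+ 2 <= L ^+ 2 * `|u - xs| ^+ 2.
Proof.
have := gradient_norm_le u; have := normr_ge0 (gf u); rewrite -exprMn => g0 gL.
by rewrite lerXn2r// nnegrE (le_trans g0).
Qed.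

(** * Differentiation, coercivity and right continuity of the energy *)

Let E_ge0 t : 0 <= E t.
Proof. by have := minf (y t); have := sqr_ge0 `|v t|; rewrite /E; lra. Qed.

Let dE t := ip (gf (y t)) (dx t + beta *: ddx t) + ip (v t) (s *: dx t + ddx t).

Lemma is_derive_energy t : t0 < t -> is_derive t 1 E (dE t).
Proof.
move=> tt; have dx_ := derx tt; have ddx_ := derdx tt.
have dy : is_derive t 1 y (dx t + beta *: ddx t).
  by apply: is_deriveD => //; exact: is_deriveZ.
have dv : is_derive t 1 v (s *: dx t + ddx t).
  apply: is_deriveD => //; apply: is_deriveZ.
  by rewrite -[X in is_derive _ _ _ X]subr0; exact: is_deriveB.
have d1 := is_derive_gradient_comp (gradf (y t)) dy.
have d2 := is_derive_norm_sqr ipP dv.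
have : is_derive t 1 ((f \o y) - cst (f xs) + (1 / 2) *: (fun u => `|v u| ^+ 2))
    (ip (gf (y t)) (dx t + beta *: ddx t) - 0
     + (1 / 2) *: (2 * ip (v t) (s *: dx t + ddx t))).
  exact: is_deriveD.
move=> /is_derive_eq; apply; rewrite /dE /GRing.scale/=; lra.
Qed.

Lemma energy_derivative_bound t : t0 < t -> dE t + k * E t <= `|z t| * `|e t|.
Proof.
move=> tt.
have yE : y t - xs = x t - xs + beta *: dx t by rewrite /y addrAC.
apply: (energy_derivative_le ipP) => //; rewrite ?s_sqr -?yE.
- exact: minimizer_quadratic_growth.
- exact: minimizer_gradient_ge.
- exact: ode.
Qed.

Let c_gt0 : 0 < c.
Proof.
by rewrite divr_gt0 ?mulr_gt0// ?lt_min ?mu_gt0 ?ltr01// lt_max ltr01 orbT.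
Qed.

(** With [A], [B] the squared norms of [v t] and [y t - xs], the Lipschitz bound gives at most
    [2 * X * (A + B)] for the squared norm of [z t], and quadratic growth gives
    [m / 2 * (A + B) <= E t]. The quotient of the two constants is [c = m / (4 * X)]. *)
Lemma energy_coercive t : c * `|z t| ^+ 2 <= E t.
Proof.
rewrite /c; set m := Num.min mu 1; set X := Num.max _ 1.
have X1 : 1 <= X by rewrite le_max lexx orbT.
have bX : beta ^+ 2 * L ^+ 2 <= X by rewrite le_max lexx.
have X0 : 0 < 4 * X by rewrite mulr_gt0// (lt_le_trans _ X1).
have m0 : 0 < m by rewrite lt_min mu_gt0 ltr01.
have m1 : m <= 1 by rewrite ge_min lexx orbT.
have mmu : m <= mu by rewrite ge_min lexx.
set A := `|v t| ^+ 2; set B := `|y t - xs| ^+ 2.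
have A0 : 0 <= A by exact: sqr_ge0.
have B0 : 0 <= B by exact: sqr_ge0.
have zle : `|z t| ^+ 2 <= 2 * X * (A + B).
  have : `|z t| ^+ 2 <= 2 * A + 2 * (beta ^+ 2 * `|gf (y t)| ^+ 2).
    have -> : beta ^+ 2 * `|gf (y t)| ^+ 2 = `|beta *: gf (y t)| ^+ 2.
      by rewrite normrZ exprMn real_normK ?num_real.
    have := sqr_ge0 `|v t - beta *: gf (y t)|.
    rewrite /z /A !(normD_sqr ipP (v t)) (ipNr ipP) normrN; lra.
  have := ler_wpM2l (sqr_ge0 beta) (gradient_norm_sqr_le (y t)).
  rewrite -/B mulrA => h1.
  have h2 := ler_wpM2r B0 bX.
  have h3 := ler_wpM2r A0 X1.
  by rewrite mul1r in h3; lra.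
have := minimizer_quadratic_growth (y t); rewrite -/B => growth.
have h4 := ler_wpM2r B0 mmu.
have h5 := ler_wpM2r A0 m1.
have h6 := ler_wpM2l (ltW m0) zle.
rewrite mulrAC ler_pdivrMr//.
have h7 : m / 2 * (A + B) <= E t by rewrite /E -/A; lra.
have := ler_wpM2l (ltW X0) h7.
by lra.
Qed.

Lemma cvg_energy_right T : t0 <= T -> E t @[t --> T^'+] --> E T.
Proof.
have [cx1 cx2] := (continuous_within_itvcyP _ _).1 cx.
have [cdx1 cdx2] := (continuous_within_itvcyP _ _).1 cdx.
rewrite le_eqVlt => /predU1P[<-|T0].
  have cy : y t @[t --> t0^'+] --> y t0.
    by apply: cvgD => //; exact: cvgZr.
  have cv : v t @[t --> t0^'+] --> v t0.
    by apply: cvgD => //; apply: cvgZr; apply: cvgB => //; exact: cvg_cst.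
  apply: cvgD.
    apply: cvgB; last exact: cvg_cst.
    apply: (cvg_comp y f cy); apply: differentiable_continuous.
    by have [] := gradf (y t0).
  apply: cvgMr; under eq_cvg do rewrite -(ip_norm ipP).
  by rewrite -(ip_norm ipP); exact: cvg_ip.
apply: cvg_at_right_filter; have [+ _] := is_derive_energy T0.
by move=> /derivable1_diffP; exact: differentiable_continuous.
Qed.

(** * Uniform bound on the perturbation coefficient *)

Let inteS (i : interval R) : [set` i] `<=` [set` `[t0, +oo[] ->
  (@lebesgue_measure R).-integrable [set` i] (EFin \o (fun t => `|e t|)).
Proof. by move=> it; apply: integrableS inte. Qed.

Let sub_itv T t : t0 <= T -> [set` `[T, t]] `<=` [set` `[t0, +oo[].
Proof.
move=> T0 u /=; rewrite !in_itv/= andbT => /andP[Tu _]; exact: le_trans Tu.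
Qed.

Lemma sqrt_energy_le t : t0 <= t ->
  Num.sqrt (E t) <= Num.sqrt (E t0)
    + (2 * Num.sqrt c)^-1 * Rintegral lebesgue_measure `[t0, +oo[ (fun t => `|e t|).
Proof.
move=> tt; set I := Rintegral _ _ _.
have sc0 : 0 < Num.sqrt c by rewrite sqrtr_gt0.
have sci0 : 0 <= (2 * Num.sqrt c)^-1.
  by rewrite invr_ge0; apply: mulr_ge0 => //; exact: ltW.
apply/ler_addgt0Pr => d d0.
(* [E] may vanish, where the square root is not differentiable; the shift by [d ^+ 2] avoids this
   and costs at most [d] in the end. *)
pose F u := Num.sqrt (E u + d ^+ 2).
have Ed u : 0 < E u + d ^+ 2 by rewrite ltr_wpDl// exprn_gt0.
have dF u : t0 < u -> is_derive u 1 F ((2 * F u)^-1 * dE u).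
  move=> u0; have dEu := is_derive_energy u0.
  have dEd : is_derive u 1 (E + cst (d ^+ 2)) (dE u).
    by rewrite -[dE u]addr0; exact: is_deriveD.
  have dsqrt : is_derive ((E + cst (d ^+ 2)) u) 1 Num.sqrt (2 * F u)^-1.
    exact (is_derive1_sqrt (Ed u)).
  exact (is_derive1_comp dsqrt dEd).
have : F t - F t0 <=
    Rintegral lebesgue_measure `[t0, t] (fun u => (2 * Num.sqrt c)^-1 * `|e u|).
  apply: (@increment_le_Rintegral _ F (fun u => (2 * F u)^-1 * dE u)) => //.
  - apply: (cvg_comp (fun u => E u + d ^+ 2) Num.sqrt); last exact: sqrt_continuous.
    by apply: cvgD; [exact: cvg_energy_right|exact: cvg_cst].
  - by move=> u /andP[u0 _]; exact: dF.
  - move=> u /andP[u0 _].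
    have F0 : 0 < F u by rewrite sqrtr_gt0.
    (* Coercivity cancels the norm of [z u] against the [F u] in the denominator of the derivative,
       leaving a multiple of the norm of [e u]. *)
    have FE : Num.sqrt c * `|z u| <= F u.
      rewrite -[`|z u|]ger0_norm// -sqrtr_sqr -sqrtrM ?(ltW c_gt0)//.
      by rewrite /F ler_wsqrtr//; have := energy_coercive u; have := sqr_ge0 d; lra.
    have dEle : dE u <= `|z u| * `|e u|.
      have := energy_derivative_bound u0.
      by have := mulr_ge0 (ltW k_gt0) (E_ge0 u); lra.
    rewrite !invfM -!mulrA ler_wpM2l ?invr_ge0//.
    rewrite mulrC ler_pdivrMr// -mulrA ler_pdivlMl//.
    apply: le_trans (ler_wpM2l (ltW sc0) dEle) _.
    by rewrite mulrA [leRHS]mulrC ler_wpM2r.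
  - exact/integrable_itvZl/inteS/sub_itv.
rewrite RintegralZl//; last exact: inteS (sub_itv (lexx t0)).
have : Rintegral lebesgue_measure `[t0, t] (fun u => `|e u|) <= I.
  by apply: ge0_subset_Rintegral_itv => //; exact: sub_itv.
move=> /(ler_wpM2l sci0) le1 le2.
have le3 : Num.sqrt (E t) <= F t by rewrite ler_wsqrtr// lerDl sqr_ge0.
have le4 : F t0 <= Num.sqrt (E t0) + d.
  have sd0 : 0 <= Num.sqrt (E t0) + d by rewrite addr_ge0 ?sqrtr_ge0 ?(ltW d0).
  rewrite -[leRHS]ger0_norm// -sqrtr_sqr /F ler_wsqrtr// sqrrD sqr_sqrtr//.
  by rewrite lerD2r lerDl mulrn_wge0// mulr_ge0 ?sqrtr_ge0 ?(ltW d0).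
by lra.
Qed.

Let M_ge0 : 0 <= M.
Proof.
rewrite addr_ge0 ?sqrtr_ge0// mulr_ge0//; last exact: Rintegral_ge0.
by rewrite div1r invr_ge0 mulr_ge0// (ltW c_gt0).
Qed.

(** Coercivity costs a factor [1 / sqrt c]; times the [1 / (2 * sqrt c)] of [sqrt_energy_le] it
    yields the [1 / (2 * c)] in [M]. *)
Lemma perturbation_coefficient_le t : t0 <= t -> `|z t| <= M.
Proof.
move=> tt; have sc0 : 0 < Num.sqrt c by rewrite sqrtr_gt0.
have : Num.sqrt c * `|z t| <= Num.sqrt (E t).
  rewrite -[`|z t|]ger0_norm// -sqrtr_sqr -sqrtrM ?(ltW c_gt0)//.
  by rewrite ler_wsqrtr//; exact: energy_coercive.
move=> /le_trans /(_ (sqrt_energy_le tt)).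
rewrite -ler_pdivlMl// => /le_trans; apply.
rewrite mulrDr /M (sqrtrM _ (E_ge0 t0)) (sqrtrV (ltW c_gt0)) mulrC lerD2l mulrA.
rewrite ler_wpM2r//.
  exact: Rintegral_ge0.
by rewrite div1r -invfM mulrCA -expr2 (sqr_sqrtr (ltW c_gt0)).
Qed.

(** * The exponentially weighted energy: explicit bound and convergence to zero *)

Let expE t := E t * expR (k * t).

Lemma is_derive_exp_energy t : t0 < t ->
  is_derive t 1 expE (expR (k * t) * (dE t + k * E t)).
Proof.
move=> tt; have dEt := is_derive_energy tt.
have dk : is_derive t 1 (k *: (id : R -> R)) (k *: 1) by exact: is_deriveZ.
have dexp := is_derive1_comp (is_derive_expR (k *: t)) dk.
have := is_deriveM dEt dexp.
move=> /is_derive_eq; apply; rewrite /GRing.scale/=; ring.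
Qed.

Lemma cvg_exp_energy_right T : t0 <= T -> expE t @[t --> T^'+] --> expE T.
Proof.
move=> T0; apply: cvgM; first exact: cvg_energy_right.
apply: (cvg_comp (fun t => k * t) expR); last exact: continuous_expR.
by apply: cvgMr; exact/cvg_at_right_filter/cvg_id.
Qed.

(** The majorant [h] serves two purposes: the exponential itself gives the explicit bound, and its
    constant value at the right endpoint gives convergence. *)
Lemma exp_energy_increment_le T t (h : R -> R) : t0 <= T -> T <= t ->
  (forall u, T < u <= t -> expR (k * u) <= h u) ->
  (forall u, T <= u <= t -> 0 <= h u) ->
  (@lebesgue_measure R).-integrable `[T, t] (EFin \o (fun u => h u * `|e u|)) ->
  expE t - expE T <=
    M * Rintegral lebesgue_measure `[T, t] (fun u => h u * `|e u|).
Proof.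
move=> T0 Tt hexp h0 inth; rewrite -RintegralZl//.
apply: (@increment_le_Rintegral _ expE
  (fun u => expR (k * u) * (dE u + k * E u))) => //.
- exact: cvg_exp_energy_right.
- by move=> u /andP[Tu _]; apply: is_derive_exp_energy; exact: le_lt_trans Tu.
- by move=> u Tut; rewrite !mulr_ge0// h0.
- move=> u Tut; have u0 : t0 < u by case/andP: Tut => + _; exact: le_lt_trans.
  apply: (@le_trans _ _ (expR (k * u) * (M * `|e u|))).
    rewrite ler_wpM2l ?expR_ge0//.
    apply: le_trans (energy_derivative_bound u0) _.
    by rewrite ler_wpM2r// perturbation_coefficient_le// ltW.
  by rewrite mulrCA ler_wpM2l// ler_wpM2r// hexp.
- exact: integrable_itvZl.
Qed.

Let integrable_exp_e t : (@lebesgue_measure R).-integrable `[t0, t]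
  (EFin \o (fun u => expR (k * u) * `|e u|)).
Proof.
have inte_t := inteS (sub_itv (t := t) (lexx t0)).
(* On [[t0, t]] the weight is dominated by its value at [t]. *)
apply: le_integrable (integrable_itvZl (expR (k * t)) inte_t) => //.
- apply/measurable_EFinP; apply: measurable_funM; last first.
    by move/integrableP: inte_t => [/measurable_EFinP].
  apply: measurable_funTS; apply: continuous_measurable_fun => u.
  apply: (cvg_comp (fun t => k * t) expR); last exact: continuous_expR.
  by apply: cvgMr; exact: cvg_id.
- move=> u /=; rewrite in_itv/= => /andP[_ ut].
  rewrite lee_fin !ger0_norm ?mulr_ge0 ?expR_ge0//.
  by rewrite ler_wpM2r// ler_expR ler_wpM2l// ltW.
Qed.

Lemma energy_bound t : t0 <= t ->
  E t <= E t0 * expR (- k * (t - t0)) + M * expR (- k * t)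
    * Rintegral lebesgue_measure `[t0, t] (fun u => expR (k * u) * `|e u|).
Proof.
move=> tt; set J := Rintegral _ _ _.
have : expE t - expE t0 <= M * J.
  exact: (exp_energy_increment_le (h := fun u => expR (k * u))).
move=> /(ler_wpM2l (expR_ge0 (- k * t))).
have <- : expR (- k * t) * expE t = E t.
  by rewrite /expE mulrCA mulNr -expRD addNr expR0 mulr1.
have -> : E t0 * expR (- k * (t - t0)) = expR (- k * t) * expE t0.
  by rewrite /expE mulrCA -expRD; congr (_ * expR _); ring.
by lra.
Qed.

(** The partial integrals are nondecreasing and bounded by the total integral; [T] is a time at
    which they come within [eps] of their supremum. *)
Lemma small_tail_integral eps : 0 < eps -> exists2 T, t0 <= T &
  forall t, T <= t -> Rintegral lebesgue_measure `[T, t] (fun u => `|e u|) <= eps.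
Proof.
move=> eps0.
pose I t := Rintegral lebesgue_measure `[t0, t] (fun u => `|e u|).
pose S := [set I t | t in [set t | t0 <= t]].
have supS : has_sup S.
  split; first by exists (I t0); exists t0 => /=.
  exists (Rintegral lebesgue_measure `[t0, +oo[ (fun u => `|e u|)) => _ [t /= tt <-].
  by apply: ge0_subset_Rintegral_itv => //; exact: sub_itv.
have [_ [T /= T0 <-] IT] := sup_adherent eps0 supS.
exists T => // t Tt.
have It : I t <= sup S.
  by apply: sup_upper_bound => //; exists t => //=; exact: le_trans Tt.
have <- : I t - I T = Rintegral lebesgue_measure `[T, t] (fun u => `|e u|).
  rewrite /I Rintegral_itvB ?bnd_simp//; last exact/inteS/sub_itv.
  rewrite Rintegral_itv_obnd_cbnd//; apply: inteS => u /=.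
  by rewrite !in_itv/= andbT => /andP[/ltW Tu _]; exact: le_trans Tu.
by lra.
Qed.

(** The estimate is restarted at a time [T] with small tail: [E t] is at most [E T] damped by
    [expR (- k * (t - T))] plus [M] times the tail, and each part is eventually at most
    [eps / 2]. *)
Lemma cvg_energy0 : E t @[t --> +oo] --> 0.
Proof.
apply/cvgrPdist_le => eps eps0.
(* Dividing by [M + 1] instead of [M] covers the case [M = 0]. *)
have eps'0 : 0 < eps / 2 / (M + 1) by rewrite !divr_gt0// ltr_wpDl.
have [T T0 tail] := small_tail_integral eps'0.
near=> t.
have Tt : T <= t by near: t; apply: nbhs_pinfty_ge; exact: num_real.
rewrite sub0r normrN ger0_norm//.
have : expE t - expE T <= M * Rintegral lebesgue_measure `[T, t]
    (fun u => expR (k * t) * `|e u|).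
  apply: (exp_energy_increment_le (h := fun=> expR (k * t))) => //.
  - by move=> u /andP[_ ut]; rewrite ler_expR ler_wpM2l// ltW.
  - exact/integrable_itvZl/inteS/sub_itv.
rewrite RintegralZl//; last exact/inteS/sub_itv.
set J := Rintegral _ _ _ => inc.
have J0 : 0 <= J by exact: Rintegral_ge0.
have MJ : M * J <= eps / 2.
  have := tail _ Tt; rewrite ler_pdivlMr ?ltr_wpDl// -/J => h.
  by apply: le_trans h; rewrite mulrDr mulr1 mulrC lerDl.
have decay : expE T <= expR (k * t) * (eps / 2).
  have : 1 + k * t <= expR (k * t) by exact: expR_ge1Dx.
  have : expE T / (eps / 2) <= k * t.
    rewrite -ler_pdivrMl//; near: t; apply: nbhs_pinfty_ge; exact: num_real.
  rewrite ler_pdivrMr ?divr_gt0// => h1 h2; apply: le_trans h1 _.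
  by rewrite ler_wpM2r ?divr_ge0 ?(ltW eps0)//; lra.
rewrite -(ler_pM2r (expR_gt0 (k * t))).
have := ler_wpM2l (expR_ge0 (k * t)) MJ.
by rewrite -/(expE t); lra.
Unshelve. all: by end_near. Qed.

(** * Velocity, position, gradient and value controlled by the energy *)

Let velocity_sqr_le t : `|dx t| ^+ 2 <= 32 * E t.
Proof.
have := minimizer_quadratic_growth (y t); rewrite -s_sqr.
have yE : y t - xs = x t - xs + beta *: dx t by rewrite /y addrAC.
(* Eliminating the position from [v] and [y] isolates the velocity with a factor of at least 1/2;
   both terms on the right are controlled by the energy. *)
have dxE : (1 - beta * s) *: dx t = v t - s *: (y t - xs).
  rewrite yE /v (scalerDr s (x t - xs)) scalerA scalerBl scale1r mulrC.
  by rewrite opprD addrACA subrr add0r.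
have : `|(1 - beta * s) *: dx t| ^+ 2 <=
    2 * `|v t| ^+ 2 + 2 * (s ^+ 2 * `|y t - xs| ^+ 2).
  have -> : s ^+ 2 * `|y t - xs| ^+ 2 = `|s *: (y t - xs)| ^+ 2.
    by rewrite normrZ exprMn real_normK ?num_real.
  have := sqr_ge0 `|v t + s *: (y t - xs)|.
  by rewrite dxE !(normD_sqr ipP (v t)) (ipNr ipP) normrN; lra.
rewrite normrZ exprMn real_normK ?num_real//.
have : 1 / 4 * `|dx t| ^+ 2 <= (1 - beta * s) ^+ 2 * `|dx t| ^+ 2.
  by rewrite ler_wpM2r ?sqr_ge0//; have := beta_s; nra.
by have := minf (y t); have := sqr_ge0 `|v t|; rewrite /E; lra.
Qed.

Let position_sqr_le t : `|x t - xs| ^+ 2 <= 20 / mu * E t.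
Proof.
have := minimizer_quadratic_growth (y t).
have xE : x t - xs = (y t - xs) - beta *: dx t by rewrite /y addrAC addrK.
have : `|x t - xs| ^+ 2 <= 2 * `|y t - xs| ^+ 2 + 2 * (beta ^+ 2 * `|dx t| ^+ 2).
  have -> : beta ^+ 2 * `|dx t| ^+ 2 = `|beta *: dx t| ^+ 2.
    by rewrite normrZ exprMn real_normK ?num_real.
  have := sqr_ge0 `|(y t - xs) + beta *: dx t|.
  by rewrite xE !(normD_sqr ipP (y t - xs)) (ipNr ipP) normrN; lra.
have : mu * beta ^+ 2 <= 1 / 4.
  rewrite -s_sqr -exprMn mulrC; have := mulr_ge0 beta_ge0 (ltW s_gt0).
  by have := beta_s; nra.
move=> /(ler_wpM2r (sqr_ge0 `|dx t|)) h1 h2 h3.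
have := ler_wpM2l (ltW mu_gt0) h2; have := velocity_sqr_le t.
have : f (y t) - f xs <= E t by have := sqr_ge0 `|v t|; rewrite /E; lra.
(* The constant is [20 = 4 + 16]: 4 from quadratic growth at [y t], and 16 from [2 * (1/4) * 32] for
   the velocity. *)
by move=> h4 h5 h6; rewrite mulrAC ler_pdivlMr//; lra.
Qed.

Let gradient_sqr_le t : `|gf (x t)| ^+ 2 <= L ^+ 2 * (20 / mu) * E t.
Proof.
apply: le_trans (gradient_norm_sqr_le (x t)) _; rewrite -mulrA.
by rewrite ler_wpM2l ?sqr_ge0.
Qed.

(** Convexity bounds the gap by [ip (gf (x t)) (x t - xs)], and Cauchy-Schwarz with the Lipschitz
    bound makes it quadratic in the distance to [xs]. The absolute value appears because the sign of
    [L] is not prescribed. *)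
Let value_le t : f (x t) - f xs <= `|L| * (20 / mu) * E t.
Proof.
have := minimizer_gradient_ge (x t).
have := mulr_ge0 (divr_ge0 (ltW mu_gt0) (ler0n R 2)) (sqr_ge0 `|x t - xs|).
have := ip_le_normM ipP (gf (x t)) (x t - xs).
have := ler_wpM2r (normr_ge0 (x t - xs)) (gradient_norm_le (x t)).
have := ler_wpM2r (sqr_ge0 `|x t - xs|) (ler_norm L).
have := ler_wpM2l (normr_ge0 L) (position_sqr_le t).
by rewrite -!mulrA -expr2; lra.
Qed.

(* [K t^-p] is a supersolution of the differential inequality for the energy:
   [k - p / t >= k / 2] once [t >= 2 p / k]. *)
Lemma energy_bigO p : 0 < p ->
  bigO_pinfty (fun t => `|e t|) (fun t => (t `^ p)^-1) ->
  bigO_pinfty E (fun t => (t `^ p)^-1).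
Proof.
move=> p0 [C C0 [T1 [_ eC]]].
pose T := `|t0| + `|T1| + 1 + 2 * p / k.
have pk0 : 0 < 2 * p / k by rewrite divr_gt0 ?mulr_gt0.
have [t0T T1T] : t0 < T /\ T1 < T.
  have := ler_norm t0; have := ler_norm T1; have := normr_ge0 t0.
  by have := normr_ge0 T1; rewrite /T; split; lra.
have pT : 2 * p / k <= T.
  by have := normr_ge0 t0; have := normr_ge0 T1; rewrite /T; lra.
have T_gt0 : 0 < T by exact: lt_le_trans pT.
have powE t : T <= t -> (t `^ p)^-1 = expR (- (p * ln t)).
  by move=> Tt; rewrite /powR gt_eqF ?expRN// (lt_le_trans T_gt0).
(* The weighted comparison function [expR (k * t) * t^-p] as a single exponential, so that its
   logarithmic derivative [k - p / t] is immediate. *)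
pose W t := expR (k * t - p * ln t).
have WE t : T <= t -> W t = expR (k * t) * (t `^ p)^-1.
  by move=> Tt; rewrite powE// /W expRD.
have dW t : T <= t -> is_derive t 1 W (W t * (k - p / t)).
  move=> Tt; have t_gt0 : 0 < t by exact: lt_le_trans Tt.
  have dk : is_derive t 1 (k *: (id : R -> R) - p *: (@ln R)) (k *: 1 - p *: t^-1).
    apply: is_deriveB; apply: is_deriveZ; exact: is_derive1_ln.
  have := is_derive1_comp
    (is_derive_expR ((k *: (id : R -> R) - p *: (@ln R)) t)) dk.
  by move=> /is_derive_eq; apply; rewrite /GRing.scale/= mulr1.
(* The first summand absorbs the perturbation, [M * C <= K * (k / 2)]; the second makes the
   comparison hold at the starting time [T]. *)
pose K := 2 * M * C / k + E T * T `^ p.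
have MC0 : 0 <= 2 * M * C / k.
  apply: divr_ge0 (ltW k_gt0); apply: mulr_ge0 (ltW C0); exact: mulr_ge0.
have K0 : 0 <= K by apply: addr_ge0 MC0 _; apply: mulr_ge0 (powR_ge0 _ _).
have KMC : M * C <= K * (k / 2).
  have : 0 <= E T * T `^ p * (k / 2).
    apply: mulr_ge0; first by apply: mulr_ge0 (powR_ge0 _ _).
    by apply: divr_ge0 => //; exact: ltW.
  have : 2 * M * C / k * (k / 2) = M * C by field; rewrite gt_eqF.
  by rewrite /K; lra.
have EK t : T <= t -> E t <= K * (t `^ p)^-1.
  move=> Tt; pose G u := expE u - K * W u.
  have dG u : T < u -> is_derive u 1 G
      (expR (k * u) * (dE u + k * E u) - K * (W u * (k - p / u))).
    move=> Tu; have dexpE := is_derive_exp_energy (lt_trans t0T Tu).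
    have dWu := dW _ (ltW Tu).
    have := is_deriveB dexpE (is_deriveZ K dWu).
    by move=> /is_derive_eq; apply.
  (* The derivative of [G] is nonpositive after [T]: the perturbation contributes at most
     [M * C * W u], while [K * W] grows at rate at least [K * (k / 2) * W u]. *)
  have : G t - G T <= Rintegral lebesgue_measure `[T, t] (fun=> 0).
    apply: (@increment_le_Rintegral _ G (fun u =>
      expR (k * u) * (dE u + k * E u) - K * (W u * (k - p / u)))) => //.
    - apply: cvgB; first exact/cvg_exp_energy_right/ltW.
      apply: cvgMr; apply: cvg_at_right_filter; have [+ _] := dW _ (lexx T).
      by move=> /derivable1_diffP; exact: differentiable_continuous.
    - by move=> u /andP[Tu _]; exact: dG.
    - move=> u /andP[Tu _]; have u_gt0 := lt_trans T_gt0 Tu.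
      have u0 := lt_trans t0T Tu.
      have pu : p / u <= k / 2.
        rewrite ler_pdivrMr//; have := lt_le_trans (le_lt_trans pT Tu) (lexx u).
        by rewrite ltr_pdivrMr//; lra.
      have h1 : dE u + k * E u <= M * (C * (u `^ p)^-1).
        apply: le_trans (energy_derivative_bound u0) _.
        apply: ler_pM => //; first exact/perturbation_coefficient_le/ltW.
        have := eC _ (lt_trans T1T Tu).
        by rewrite normr_id (ger0_norm (_ : 0 <= (u `^ p)^-1)) ?invr_ge0 ?powR_ge0.
      have h2 := ler_wpM2l (expR_ge0 (k * u)) h1.
      have W0 : 0 <= W u by exact: expR_ge0.
      have h3 := ler_wpM2r W0 KMC.
      have h4 := ler_wpM2l (mulr_ge0 K0 W0) pu.
      have h5 : expR (k * u) * (M * (C * (u `^ p)^-1)) = M * C * W u.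
        by rewrite WE ?(ltW Tu)//; ring.
      by lra.
    - exact: integrable0.
  rewrite /Rintegral integral0 /=.
  have GT : G T <= 0.
    rewrite /G /expE WE// /K.
    have : 0 <= 2 * M * C / k * (expR (k * T) * (T `^ p)^-1).
      by apply: mulr_ge0 MC0 _; rewrite mulr_ge0 ?expR_ge0 ?invr_ge0 ?powR_ge0.
    have : E T * T `^ p * (expR (k * T) * (T `^ p)^-1) = E T * expR (k * T).
      by field; rewrite gt_eqF// powR_gt0.
    by lra.
  move=> GtT; have : G t <= 0 by lra.
  rewrite /G /expE WE// mulrCA [E t * _]mulrC -mulrBr pmulr_rle0 ?expR_gt0//.
  by rewrite subr_le0.
exists (K + 1); first by rewrite ltr_wpDl.
near=> t; have Tt : T <= t by near: t; apply: nbhs_pinfty_ge; exact: num_real.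
rewrite !ger0_norm ?invr_ge0 ?powR_ge0//.
apply: le_trans (EK _ Tt) _; rewrite ler_wpM2r ?invr_ge0 ?powR_ge0//.
by rewrite lerDl.
Unshelve. all: by end_near. Qed.

Lemma cvg_trajectory :
  [/\ f (x t) @[t --> +oo] --> f xs,
      `|x t - xs| @[t --> +oo] --> 0,
      `|gf (x t)| @[t --> +oo] --> 0
    & `|dx t| @[t --> +oo] --> 0].
Proof.
have E0 := cvg_energy0; split.
- have : f (x t) - f xs @[t --> +oo] --> 0.
    apply: cvg0_of_le_scale E0 => t; last exact: value_le.
    by rewrite subr_ge0.
  by move=> /cvg_sub0; apply; exact: cvg_cst.
- apply: cvg0_of_sqr => //; apply: cvg0_of_le_scale E0 => t; last exact: position_sqr_le.
  exact: sqr_ge0.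
- apply: cvg0_of_sqr => //; apply: cvg0_of_le_scale E0 => t; last exact: gradient_sqr_le.
  exact: sqr_ge0.
- apply: cvg0_of_sqr => //; apply: cvg0_of_le_scale E0 => t; last exact: velocity_sqr_le.
  exact: sqr_ge0.
Qed.

Lemma bigO_trajectory r : bigO_pinfty E r ->
  [/\ bigO_pinfty (fun t => f (x t) - f xs) r,
      bigO_pinfty (fun t => `|x t - xs| ^+ 2) r,
      bigO_pinfty (fun t => `|dx t| ^+ 2) r
    & bigO_pinfty (fun t => `|gf (x t)| ^+ 2) r].
Proof.
have mu20 : 0 <= 20 / mu by rewrite divr_ge0// ltW.
move=> OE; split.
- apply: bigO_pinfty_of_le_scale value_le OE; first exact: mulr_ge0.
  by move=> t; rewrite subr_ge0.
- by apply: bigO_pinfty_of_le_scale position_sqr_le OE => // t; exact: sqr_ge0.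
- by apply: bigO_pinfty_of_le_scale velocity_sqr_le OE => // t; exact: sqr_ge0.
- apply: bigO_pinfty_of_le_scale gradient_sqr_le OE => [|t]; last exact: sqr_ge0.
  by rewrite mulr_ge0 ?sqr_ge0.
Qed.
End Trajectory.

Unset Implicit Arguments.

Theorem theorem10 (R : realType) (V : completeNormedModType R)
  (ip : V -> V -> R) (t0 mu L beta : R)
  (f : V -> R) (gf : V -> V) (xs : V)
  (e x dx ddx : R -> V) :
  inner_product ip ->
  0 < t0 -> 0 < mu ->
                                 
  (forall y, is_gradient ip f y (gf y)) -> continuous gf ->
  strongly_convex mu f ->
  (forall y z, `|gf y - gf z| <= L * `|y - z|) ->
                                
  (forall y, f xs <= f y) ->
                                               
  {within `[t0, +oo[, continuous x} ->
  {within `[t0, +oo[, continuous dx} ->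
  (forall t, t0 < t -> is_derive t 1 x (dx t)) ->
  (forall t, t0 < t -> is_derive t 1 dx (ddx t)) ->
  (forall t, t0 < t ->
     ddx t + (2 * Num.sqrt mu) *: dx t + gf (x t + beta *: dx t) + e t = 0) ->
           
  0 <= beta <= 1 / (2 * Num.sqrt mu) ->
           
  (@lebesgue_measure R).-integrable `[t0, +oo[ (fun t => (`|e t|)%:E) ->
  let E := fun t => f (x t + beta *: dx t) - f xs
                    + 1 / 2 * `|Num.sqrt mu *: (x t - xs) + dx t| ^+ 2 in
  let c := Num.min mu 1 / (4 * Num.max (beta ^+ 2 * L ^+ 2) 1) in
  let M := Num.sqrt (E t0 / c)
           + 1 / (2 * c) * Rintegral lebesgue_measure `[t0, +oo[ (fun t => `|e t|) in
           
  ((forall t, t0 <= t ->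
      E t <= E t0 * expR (- (Num.sqrt mu / 2) * (t - t0))
             + M * expR (- (Num.sqrt mu / 2) * t)
               * Rintegral lebesgue_measure `[t0, t]
                   (fun tau => expR (Num.sqrt mu / 2 * tau) * `|e tau|))
   /\ E t @[t --> +oo] --> 0
   /\ f (x t) @[t --> +oo] --> f xs
   /\ `|x t - xs| @[t --> +oo] --> 0
   /\ `|gf (x t)| @[t --> +oo] --> 0
   /\ `|dx t| @[t --> +oo] --> 0)
  /\
            
  (forall p : R, 0 < p ->
     bigO_pinfty (fun t => `|e t|) (fun t => (t `^ p)^-1) ->
     [/\ bigO_pinfty E (fun t => (t `^ p)^-1),
         bigO_pinfty (fun t => f (x t) - f xs) (fun t => (t `^ p)^-1),
         bigO_pinfty (fun t => `|x t - xs| ^+ 2) (fun t => (t `^ p)^-1),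
         bigO_pinfty (fun t => `|dx t| ^+ 2) (fun t => (t `^ p)^-1)
       & bigO_pinfty (fun t => `|gf (x t)| ^+ 2) (fun t => (t `^ p)^-1)]).
Proof.
move=> ipP _ mu_gt0 gradf _ cvxf lipf minf cx cdx derx derdx ode beta_le inte E c M.
split.
  split; first by move=> t tt; exact: (energy_bound ipP).
  split; first exact (cvg_energy0 ipP mu_gt0 gradf cvxf lipf minf cx cdx derx derdx
      ode beta_le inte).
  by have [] := cvg_trajectory ipP mu_gt0 gradf cvxf lipf minf cx cdx derx derdx
    ode beta_le inte.
move=> p p0 Oe.
have OE : bigO_pinfty E (fun t => (t `^ p)^-1).
  exact: (energy_bigO ipP mu_gt0 gradf cvxf lipf minf cx cdx derx derdx ode).
by have [] := bigO_trajectory ipP mu_gt0 gradf cvxf lipf minf beta_le OE; split.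
Qed.
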